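(* Let $n\ge 1$ and let $s$ be the largest integer such that $n+1\ge(2s+1)(s+1)$. Then the Stanley depth of any nonzero squarefree monomial ideal $I$ of $S=K[x_1,\dots,x_n]$ is greater than or equal to $2s+1$. Explicitly, this lower bound is $$2s+1=2\left\lfloor\frac{\sqrt{2n+2.25}+0.5}{2}\right\rfloor-1.$$
   Context: $K$ is a field and $S=K[x_1,\dots,x_n]$ with its standard $\mathbb{Z}^n$-grading. A squarefree monomial ideal is an ideal generated by squarefree monomials. Stanley depth: a Stanley decomposition of a finitely generated $\mathbb{Z}^n$-graded $S$-module $M$ is a finite direct sum decomposition $M=\bigoplus_{i=1}^r u_iK[Z_i]$ as a $\mathbb{Z}^n$-graded $K$-vector space, where each $u_i\in M$ is a homogeneous element, $Z_i\subseteq\{x_1,\dots,x_n\}$ is a set of variables, and $u_iK[Z_i]$ is a free $K[Z_i]$-submodule of $M$. The Stanley depth of the decomposition is $\min_i|Z_i|$, and the Stanley depth of $M$ is the maximum of the Stanley depths of its Stanley decompositions. *)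

(* Defs.v *)
From HB Require Import structures.
From mathcomp Require Import all_boot all_order all_algebra.
From mathcomp Require Import mpoly.
From mathcomp Require Import boolp classical_sets reals.

Set Implicit Arguments.
Unset Strict Implicit.
Unset Printing Implicit Defensive.

Import Order.TTheory GRing.Theory Num.Theory.
Local Open Scope ring_scope.
Local Open Scope classical_set_scope.

Section StanleyDepth.
Variables (K : fieldType) (n : nat).
Notation S := {mpoly K[n]}.

Definition squarefree_monomial (f : S) : Prop :=
  exists2 m : 'X_{1..n}, (forall i, (m i <= 1)%N) & f = 'X_[m].

Definition ideal_generated (G : set S) : set S :=
  [set f | exists (r : nat) (c g : 'I_r -> S),
     (forall i, G (g i)) /\ f = \sum_(i < r) c i * g i].

Definition squarefree_monomial_ideal (I : set S) : Prop :=
  exists2 G : set S, G `<=` squarefree_monomial & I = ideal_generated G.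

(* The component of degree [a] in the standard Z^n-grading of S, where
   'X_i has the i-th unit vector as degree. *)
Definition Zn_component (a : 'rV[int]_n) : set S :=
  [set f | forall m, m \in msupp f -> forall i, (m i)%:Z = a 0 i].

Definition Zn_homogeneous (f : S) : Prop := exists a, Zn_component a f.

(* The subring K[Z] of S, for Z a set of (indices of) variables. *)
Definition subpolyring (Z : {set 'I_n}) : set S :=
  [set p | forall m i, m \in msupp p -> m i != 0%N -> i \in Z].

(* u K[Z] *)
Definition stanley_space (u : S) (Z : {set 'I_n}) : set S :=
  [set f | exists2 p, subpolyring Z p & f = p * u].

(* I is the internal direct sum of the u_i K[Z_i], i < r. Each u_i K[Z_i] is a
   Z^n-graded subspace because u_i is homogeneous, so this is also a
   decomposition of Z^n-graded vector spaces. *)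
Record stanley_decomposition (I : set S) (r : nat)
    (u : 'I_r -> S) (Z : 'I_r -> {set 'I_n}) : Prop := StanleyDecomposition {
  stanley_mem : forall i, I (u i);
  stanley_homog : forall i, Zn_homogeneous (u i);
  stanley_free : forall i p, subpolyring (Z i) p -> p * u i = 0 -> p = 0;
  stanley_sum : forall f, I f <->
    exists2 w : 'I_r -> S,
      (forall i, stanley_space (u i) (Z i) (w i)) & f = \sum_(i < r) w i;
  stanley_direct : forall w : 'I_r -> S,
    (forall i, stanley_space (u i) (Z i) (w i)) ->
    \sum_(i < r) w i = 0 -> forall i, w i = 0 }.

(* Minimum of the #|Z i|. Since #|Z i| <= n, the neutral element n only matters
   for r = 0, which does not occur in a decomposition of a nonzero ideal. *)
Definition decomposition_sdepth (r : nat) (Z : 'I_r -> {set 'I_n}) : nat :=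
  \big[minn/n]_(i < r) #|Z i|.

(* The maximum can be taken over d <= n, as no decomposition has larger depth. *)
Definition sdepth (I : set S) : nat :=
  (\max_(d < n.+1 | `[< exists (r : nat) (u : 'I_r -> S)
                              (Z : 'I_r -> {set 'I_n}),
                          stanley_decomposition I u Z
                          /\ decomposition_sdepth Z = d >]) d)%N.

End StanleyDepth.

Definition is_largest_int (P : int -> Prop) (s : int) : Prop :=
  P s /\ forall t, P t -> t <= s.

(* Main.v *)
Require Import Defs.
From HB Require Import structures.
From mathcomp Require Import all_boot all_order all_algebra.
From mathcomp Require Import mpoly.
From mathcomp Require Import boolp classical_sets reals.
From mathcomp Require Import zify ring lra.

(** A squarefree monomial ideal [I] is described by the
    up-closed family [U] of the supports of its monomials. A partition of [U]
    into intervals [[A, B]] of the Boolean lattice yields the Stanley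
    decomposition [I = \bigoplus x^A K[B]], so it suffices to partition every
    up-closed family into intervals whose upper ends have at least [2s+1]
    elements.

    The upper end [interval_top s A] is defined for all subsets [A] at once,
    independently of [U]. If [#|A| = d <= 2s], the [n] variables and one extra
    place are put on a circle; walking around the circle, a variable of [A]
    counts [q], a variable outside [A] counts [-1] and the extra place counts
    [c], where [d + q d + c + g = n] with [g = 2s+1-d]. The walk loses [g] per
    turn, and as it only goes down by unit steps it reaches a new strict minimum
    exactly [g] times per turn (cycle lemma, [card_gaps]), always at a variable
    outside [A]. These [g] gaps are added to [A]. For [d > 2s] the upper end is
    [A] itself.

    The key point is [gaps_exchange]: if [#|A'| <= #|A|], [A] is contained in
    the upper end of [A'] and [A'] in the upper end of [A], then [A'] is
    contained in [A]. Otherwise some [a'] of [A' \ A] is a gap of [A]. Follow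
    the walk of [A'] from [a'] until it first returns to its level. No gap of
    [A'] occurs on the way, so the elements of [A] met there belong to [A'],
    hence the walk of [A] falls by at least [q' + 1] over the same stretch of at
    most one turn. But from a minimum it can only fall by [g <= q'] in one turn.
    The numerical conditions ([q] and [c] nonincreasing in [d], [c >= 0] and
    [g <= q']) hold for [q = max(s, 2s+1-d)] as soon as [n >= 1] and
    [n+1 >= (2s+1)(s+1)].

    Given this exchange property, a greedy choice works for every [U]: by
    increasing size, each member of [U] not yet covered becomes the lower end of
    a new interval, and the exchange property makes the intervals disjoint
    ([greedy_interval_partition]). The closed formula for [2s+1] is the
    solution of a quadratic inequality ([floor_sqrt_bound]). *)

Set Implicit Arguments.
Unset Strict Implicit.
Unset Printing Implicit Defensive.

Import Order.TTheory GRing.Theory Num.Theory.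
Local Open Scope ring_scope.

(** * Periodic walks and their successive minima *)

(** Height of the walk with steps [w] after [k] steps. *)
Definition height (w : nat -> int) (k : nat) : int := \sum_(i < k) w i.

Lemma heightS w k : height w k.+1 = height w k + w k.
Proof. by rewrite /height big_ord_recr. Qed.

(** The steps have period [N], go down by at most one, and lose [g] per period. *)
Definition periodic_walk (N g : nat) (w : nat -> int) : Prop :=
  [/\ forall k, w (k + N)%N = w k, forall k, -1 <= w k & height w N = - g%:Z].

Lemma height_period N g w k : periodic_walk N g w ->
  height w (k + N) = height w k - g%:Z.
Proof.
move=> [per _ tot]; elim: k => [|k IHk].
  by rewrite add0n tot /height big_ord0 add0r.
by rewrite addSn !heightS IHk per; ring.
Qed.

(** Step [k] takes the walk strictly below all its earlier heights. *)
Definition new_min (w : nat -> int) (k : nat) : bool :=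
  [forall j : 'I_k.+1, height w k.+1 < height w j].

Lemma new_minP w k :
  reflect (forall j, (j <= k)%N -> height w k.+1 < height w j) (new_min w k).
Proof.
apply: (iffP forallP) => H j; last by apply: H; rewrite -ltnS.
by rewrite -ltnS => jk; have := H (Ordinal jk).
Qed.

(** Heights are recorded from time [0] only: once a full period of heights is
    known, a new minimum recurs one period later. *)
Lemma new_min_period N g w k : periodic_walk N g w -> (N <= k.+1)%N ->
  new_min w k -> new_min w (k + N).
Proof.
move=> pw Nk /new_minP min_k; apply/new_minP => j jk.
have := height_period k.+1 pw; rewrite addSn => ->.
have [jN | Nj] := ltnP j N; first by have := min_k j ltac:(lia); lia.
have := height_period (j - N) pw; rewrite subnK // => ->.
by have := min_k (j - N)%N ltac:(lia); lia.
Qed.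

(** Minimum of the heights up to time [k]. *)
Fixpoint run_min (w : nat -> int) (k : nat) : int :=
  if k is k'.+1 then Num.min (run_min w k') (height w k) else height w 0.

Lemma run_min_le w j k : (j <= k)%N -> run_min w k <= height w j.
Proof.
elim: k => [|k IHk]; first by rewrite leqn0 => /eqP->.
rewrite leq_eqVlt => /predU1P[-> | jk] /=; rewrite ge_min ?lexx ?orbT //.
by rewrite IHk.
Qed.

Lemma run_min_attained w k : exists2 j, (j <= k)%N & run_min w k = height w j.
Proof.
elim: k => [|k [j jk IHk]]; first by exists 0%N.
rewrite /=; case: (leP (run_min w k) (height w k.+1)) => _; last by exists k.+1.
by exists j => //; apply: leqW.
Qed.

Lemma run_minS w k : -1 <= w k ->
  run_min w k.+1 = run_min w k - (new_min w k : nat)%:Z.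
Proof.
move=> wk; have [j jk Ej] := run_min_attained w k.
have le_k := run_min_le w (leqnn k).
have E := heightS w k.
have [/new_minP/(_ j jk) | /negP nm] := boolP (new_min w k) => /=.
  by move=> lt_j; rewrite minEle; case: ifP => ?; lia.
rewrite minEle; case: ifP => [_|/negbT Hgt]; first by rewrite subr0.
case: nm; apply/new_minP => i ik; have := run_min_le w ik; lia.
Qed.

Lemma run_min_period N g w k : periodic_walk N g w -> (N <= k.+1)%N ->
  run_min w (k + N) = run_min w k - g%:Z.
Proof.
move=> pw Nk; apply/le_anti/andP; split.
  have [j jk ->] := run_min_attained w k.
  by rewrite -(height_period j pw) run_min_le // leq_add2r.
have [j jk ->] := run_min_attained w (k + N).
have [jN | Nj] := ltnP j N.
  by have := @run_min_le w j k ltac:(lia); lia.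
have := height_period (j - N) pw; rewrite subnK // => ->.
by have := @run_min_le w (j - N) k ltac:(lia); lia.
Qed.

(** Cycle lemma: the running minimum loses [g] per period, one unit at each new
    minimum. *)
Lemma count_new_min N g w : periodic_walk N g w ->
  (\sum_(i < N) new_min w (N + i))%N = g.
Proof.
move=> pw; have [_ wge _] := pw.
suff H m : run_min w (N + m) = run_min w N -
    (\sum_(i < m) new_min w (N + i))%N%:Z.
  by have := H N; rewrite (run_min_period pw (leqnSn N)); lia.
elim: m => [|m IHm]; first by rewrite big_ord0 addn0 subr0.
by rewrite addnS run_minS // IHm big_ord_recr /=; lia.
Qed.

(** * The walk of a subset around the circle *)

(** Steps of the walk of [A]. The circle has [n + 1] places: place [i < n] is the
    variable of index [i], place [n] is the extra place, of weight [c]; times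
    are reduced modulo [n + 1]. *)
Definition circle_weight n (A : {set 'I_n}) (q c k : nat) : int :=
  if (insub (k %% n.+1)%N : option 'I_n) is Some i
  then if i \in A then q%:Z else -1 else c%:Z.

Lemma circle_weight_ord n (A : {set 'I_n}) q c k (i : 'I_n) :
  (k %% n.+1)%N = i -> circle_weight A q c k = if i \in A then q%:Z else -1.
Proof. by rewrite /circle_weight => ->; rewrite valK. Qed.

Lemma modn_circle n k :
  (exists i : 'I_n, (k %% n.+1)%N = i) \/ (k %% n.+1)%N = n.
Proof.
have := ltn_pmod k (ltn0Sn n); rewrite ltnS leq_eqVlt => /predU1P[|lt_n]; auto.
by left; exists (Ordinal lt_n).
Qed.

Lemma circle_weight_infty n (A : {set 'I_n}) q c k :
  (k %% n.+1)%N = n -> circle_weight A q c k = c%:Z.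
Proof. by rewrite /circle_weight => ->; rewrite insubN // ltnn. Qed.

Lemma circle_weight_walk n (A : {set 'I_n}) q c g :
  (#|A| + q * #|A| + c + g)%N = n ->
  periodic_walk n.+1 g (circle_weight A q c).
Proof.
move=> bal; split=> [k|k|].
- by rewrite /circle_weight modnDr.
- have [[i /circle_weight_ord->]|/circle_weight_infty->] := modn_circle n k.
    by case: ifP; lia.
  by lia.
rewrite heightS (circle_weight_infty _ _ _ (modn_small (ltnSn n))).
have -> : height (circle_weight A q c) n =
    \sum_(i : 'I_n) ((i \in A)%:Z * q.+1%:Z - 1).
  apply: eq_bigr => i _.
  have /circle_weight_ord-> : (i %% n.+1)%N = i.
    by rewrite modn_small // ltnS ltnW.
  by case: (i \in A) => /=; lia.
rewrite sumrB -mulr_suml sumr_const card_ord.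
have -> : \sum_(i : 'I_n) (i \in A)%:Z = #|A|%:Z.
  rewrite -sum1_card (big_morph Posz PoszD (erefl _)) [RHS]big_mkcond /=.
  by apply: eq_bigr => i _; case: (i \in A).
by rewrite natz; clear -bal; nia.
Qed.

(** The variables at which the walk of [A] reaches a new minimum. They are read
    off on the second turn, where the past covers at least a full turn. *)
Definition gaps n (A : {set 'I_n}) (q c : nat) : {set 'I_n} :=
  [set i : 'I_n | new_min (circle_weight A q c) (n.+1 + i)].

Lemma modn_circle_ord n (i : 'I_n) : ((n.+1 + i) %% n.+1)%N = i.
Proof. by rewrite modnDl modn_small // ltnS ltnW. Qed.

Lemma new_min_lt0 w k : new_min w k -> w k < 0.
Proof. by move/new_minP/(_ k (leqnn k)); rewrite heightS; lia. Qed.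

Lemma gaps_notin n (A : {set 'I_n}) q c i : i \in gaps A q c -> i \notin A.
Proof.
rewrite inE => /new_min_lt0.
by rewrite (circle_weight_ord _ _ _ (modn_circle_ord i)); case: ifP.
Qed.

Lemma card_gaps n (A : {set 'I_n}) q c g :
  (#|A| + q * #|A| + c + g)%N = n -> #|gaps A q c| = g.
Proof.
move=> /circle_weight_walk pw; rewrite -(count_new_min pw) big_ord_recr /=.
have [/new_min_lt0|_] := boolP (new_min _ (n.+1 + n)).
  by rewrite circle_weight_infty ?modnDl ?modn_small.
rewrite addn0 -sum1_card big_mkcond /=; apply: eq_bigr => i _.
by rewrite inE; case: ifP.
Qed.

(** The exchange property for the gaps, in terms of the parameters of the two
    walks. *)
Lemma gaps_exchange n (A A' : {set 'I_n}) q q' c c' g g' :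
  (#|A| + q * #|A| + c + g)%N = n -> (#|A'| + q' * #|A'| + c' + g')%N = n ->
  (q <= q')%N -> (c <= c')%N -> (g <= q')%N ->
  A \subset A' :|: gaps A' q' c' -> A' \subset A :|: gaps A q c ->
  A' \subset A.
Proof.
move=> bal bal' le_q le_c le_g sAA' sA'A.
apply/fintype.subsetP => i iA'; apply: contraT => iNA.
have : i \in gaps A q c.
  by have /finset.setUP[/(negP iNA)|] := fintype.subsetP sA'A i iA'.
rewrite inE; move Ea: (n.+1 + i)%N => a /new_minP min_a.
have modn_a : (a %% n.+1)%N = i by rewrite -Ea modn_circle_ord.
have lt_in := ltn_ord i.
have pw := circle_weight_walk bal; have pw' := circle_weight_walk bal'.
set w := circle_weight A q c in pw min_a.
set w' := circle_weight A' q' c' in pw'.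
have wa : w a = -1.
  by rewrite /w (circle_weight_ord _ _ _ modn_a) (negPf iNA).
have wa' : w' a = q'.
  by rewrite /w' (circle_weight_ord _ _ _ modn_a) iA'.
(* [m] is the first return time of the walk of [A'] to its level at time [a];
   it exists, and is at most one turn, as the walk does not rise over a turn. *)
pose back k := (0 < k)%N && (height w' (a + k) <= height w' a).
have ex_back : exists k, back k.
  by exists n.+1; rewrite /back /= (height_period a pw'); lia.
case: (ex_minnP ex_back) => m /andP[m_gt0 back_m] min_m.
have le_m : (m <= n.+1)%N.
  by apply: min_m; rewrite /back /= (height_period a pw'); lia.
have above k : (0 < k < m)%N -> height w' a < height w' (a + k).
  move=> /andP[k_gt0 lt_km]; rewrite ltNge; apply/negP => le_k.
  by have := min_m k; rewrite /back k_gt0 le_k => /(_ isT); lia.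
(* Before the return, an element of [A] must be in [A']: otherwise it would be
   a gap of [A'], and the walk of [A'] would go below its level at time [a]. *)
have le_w k : (0 < k < m)%N -> w (a + k)%N <= w' (a + k)%N.
  move=> km; have lt_k := above k km.
  have [[j Ej]|Einf] := modn_circle n (a + k); last first.
    by rewrite /w /w' !circle_weight_infty //; lia.
  rewrite /w /w' !(circle_weight_ord _ _ _ Ej).
  have [jA|_] := boolP (j \in A); last by case: ifP; lia.
  have [_|jNA'] := boolP (j \in A'); first by lia.
  have /finset.setUP[/(negP jNA')//|] := fintype.subsetP sAA' j jA.
  rewrite inE => min_j.
  have {min_j} /new_minP/(_ a) : new_min w' (a + k).
    have [Ek|Ek] : (a + k)%N = (n.+1 + j)%N \/ (a + k)%N = (n.+1 + j + n.+1)%N.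
      have := divn_eq (a + k) n.+1; rewrite Ej.
      have ak1 : (n.+1 <= a + k)%N by lia.
      have ak3 : (a + k < 3 * n.+1)%N by lia.
      have : ((a + k) %/ n.+1 < 3)%N by rewrite ltn_divLR.
      have : (0 < (a + k) %/ n.+1)%N by rewrite divn_gt0.
      by case: ((a + k) %/ n.+1)%N => [|[|[|e]]] *; lia.
    by rewrite Ek.
    by rewrite Ek; apply: (new_min_period pw') min_j; lia.
  rewrite heightS {2}/w' (circle_weight_ord _ _ _ Ej) (negPf jNA').
  by move=> /(_ (leq_addr _ _)); lia.
(* At [a] itself the steps are [-1] and [q'], whence the extra [q' + 1]. *)
have drop k : (0 < k <= m)%N ->
    height w (a + k) - height w a <= height w' (a + k) - height w' a - q'.+1%:Z.
  elim: k => // k IHk /andP[_ lt_km].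
  rewrite addnS !heightS; case: k IHk lt_km => [|k] IHk lt_km.
    by rewrite addn0 wa wa'; lia.
  have := IHk ltac:(lia); have := le_w k.+1 ltac:(lia); lia.
(* One turn earlier, at time [a + m - (n + 1) <= a], the walk of [A] was not
   below its level at time [a]. *)
have := drop m ltac:(lia).
have := height_period (a + m - n.+1) pw.
rewrite subnK; last by lia.
have := min_a (a + m - n.+1)%N ltac:(lia).
by rewrite heightS wa; lia.
Qed.

(** * Upper ends of the intervals *)

(** The weight [q] given to the elements of a set of size [d]. It is at least the
    number [2s+1-d] of gaps wanted, and its product with [d] does not decrease
    with [d], so that the weight [n - (2s+1) - q d] of the extra place does not
    increase. *)
Definition slope (s d : nat) : nat := maxn s (2 * s + 1 - d).

Lemma slope_anti s d e : (d <= e)%N -> (slope s e <= slope s d)%N.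
Proof. by rewrite /slope; lia. Qed.

Lemma slope_mul_mono s d e : (d <= e)%N -> (slope s d * d <= slope s e * e)%N.
Proof.
elim: e => [|e IHe]; first by rewrite leqn0 => /eqP->.
rewrite leq_eqVlt => /predU1P[-> // | /IHe /leq_trans]; apply.
have [le_es | lt_se] := leqP e s; last first.
  have -> : slope s e = s by rewrite /slope; lia.
  have -> : slope s e.+1 = s by rewrite /slope; lia.
  by rewrite leq_mul.
have -> : slope s e = (2 * s + 1 - e)%N by rewrite /slope; lia.
have -> : slope s e.+1 = (2 * s - e)%N by rewrite /slope; lia.
have -> : (2 * s + 1 - e = e + 2 * (s - e) + 1)%N by lia.
have -> : (2 * s - e = e + 2 * (s - e))%N by lia.
nia.
Qed.

Lemma slope_bound n s d : (0 < n)%N -> ((2 * s + 1) * (s + 1) <= n + 1)%N ->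
  (d <= 2 * s)%N -> (d + slope s d * d + (2 * s + 1 - d) <= n)%N.
Proof.
move=> n_gt0 le_n le_d; have := slope_mul_mono s le_d.
have -> : slope s (2 * s) = maxn s 1 by rewrite /slope; lia.
by case: s le_n le_d => [|s]; nia.
Qed.

(** The upper end of the interval that starts at [A]. *)
Definition interval_top n (s : nat) (A : {set 'I_n}) : {set 'I_n} :=
  if (#|A| <= 2 * s)%N
  then A :|: gaps A (slope s #|A|) (n - (2 * s + 1) - slope s #|A| * #|A|)
  else A.

Lemma sub_interval_top n s (A : {set 'I_n}) : A \subset interval_top s A.
Proof. by rewrite /interval_top; case: ifP => // _; apply: finset.subsetUl. Qed.

Lemma slope_balance n s d : (0 < n)%N ->
  ((2 * s + 1) * (s + 1) <= n + 1)%N -> (d <= 2 * s)%N ->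
  (d + slope s d * d + (n - (2 * s + 1) - slope s d * d) + (2 * s + 1 - d)
   = n)%N.
Proof. by move=> n_gt0 le_n le_d; have := slope_bound n_gt0 le_n le_d; lia. Qed.

Lemma card_interval_top n s (A : {set 'I_n}) : (0 < n)%N ->
  ((2 * s + 1) * (s + 1) <= n + 1)%N -> (2 * s + 1 <= #|interval_top s A|)%N.
Proof.
move=> n_gt0 le_n; rewrite /interval_top; case: ifP => [le_A | ]; last by lia.
have bal := slope_balance n_gt0 le_n le_A.
rewrite cardsU (card_gaps bal).
suff -> : A :&: gaps A (slope s #|A|) (n - (2 * s + 1) - slope s #|A| * #|A|)
    = finset.set0 by rewrite cards0; lia.
apply/eqP; rewrite finset.setI_eq0 disjoint_sym finset.disjoints_subset.
by apply/fintype.subsetP => i /gaps_notin; rewrite finset.in_setC.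
Qed.

Lemma interval_top_exchange n s (A A' : {set 'I_n}) : (0 < n)%N ->
  ((2 * s + 1) * (s + 1) <= n + 1)%N -> (#|A'| <= #|A|)%N ->
  A \subset interval_top s A' -> A' \subset interval_top s A -> A' \subset A.
Proof.
move=> n_gt0 le_n le_A; rewrite /interval_top.
case: (leqP #|A| (2 * s)) => [le_As | //].
have le_As' := leq_trans le_A le_As; rewrite le_As'.
apply: gaps_exchange (slope_balance n_gt0 le_n le_As)
  (slope_balance n_gt0 le_n le_As') _ _ _; first exact: slope_anti.
  by have := slope_mul_mono s le_A; lia.
by rewrite /slope; lia.
Qed.

(** * Interval partitions of up-closed families *)

(** The members of [U] are treated by increasing size, and those not covered yet
    start a new interval. Nothing is assumed of [U] here: the intervals cover
    [U] and are pairwise disjoint, but lie in [U] only if [U] is up-closed. *)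
Lemma greedy_interval_partition n (top : {set 'I_n} -> {set 'I_n})
    (U : {set {set 'I_n}}) :
  (forall A : {set 'I_n}, A \subset top A) ->
  (forall A A' : {set 'I_n}, (#|A'| <= #|A|)%N ->
     A \subset top A' -> A' \subset top A -> A' \subset A) ->
  exists D : {set {set 'I_n}},
    [/\ D \subset U,
        forall X, X \in U ->
          exists2 A, A \in D & (A \subset X) && (X \subset top A) &
        forall A A' X : {set 'I_n}, A \in D -> A' \in D ->
          (A \subset X) && (X \subset top A) ->
          (A' \subset X) && (X \subset top A') -> A = A'].
Proof.
move=> sub_top exch.
suff /(_ n.+1) [D [sDU cov disj]] : forall k, exists D : {set {set 'I_n}},
    [/\ D \subset [set A in U | (#|A| < k)%N],
        forall X, X \in U -> (#|X| < k)%N ->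
          exists2 A, A \in D & (A \subset X) && (X \subset top A) &
        forall A A' X : {set 'I_n}, A \in D -> A' \in D ->
          (A \subset X) && (X \subset top A) ->
          (A' \subset X) && (X \subset top A') -> A = A'].
  exists D; split=> // [|X XU].
    apply/fintype.subsetP => A /(fintype.subsetP sDU).
    by rewrite finset.inE => /andP[].
  by apply: cov => //; rewrite ltnS (leq_trans (max_card _)) ?card_ord.
elim=> [|k [D [sDU cov disj]]].
  exists finset.set0; split=> //; first exact: finset.sub0set.
  by move=> A A' X; rewrite finset.inE.
(* the uncovered members of size [k] *)
pose new := [set A in U | (#|A| == k) &&
  [forall B in D, ~~ ((B \subset A) && (A \subset top B))]].
exists (D :|: new); split.
- apply/fintype.subsetP => A /finset.setUP[/(fintype.subsetP sDU)|];
    rewrite !finset.inE.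
    by move=> /andP[-> /ltnW].
  by move=> /andP[-> /andP[/eqP-> _]] /=.
- move=> X XU; rewrite ltnS leq_eqVlt => /predU1P[Xk | /(cov _ XU)[A AD AX]].
    have [/existsP[A /andP[AD AX]] | Xnew] :=
      boolP [exists A, (A \in D) && ((A \subset X) && (X \subset top A))].
      by exists A => //; rewrite finset.inE AD.
    exists X; last by rewrite subxx sub_top.
    rewrite !finset.inE XU Xk eqxx /=; apply/orP; right.
    apply/forall_inP => B BD; apply: contra Xnew => BX.
    by apply/existsP; exists B; rewrite BD.
  by exists A => //; rewrite finset.inE AD.
- have newP (A A' X : {set 'I_n}) : A \in new -> A' \in D :|: new ->
      (A \subset X) && (X \subset top A) ->
      (A' \subset X) && (X \subset top A') -> A = A'.
    rewrite finset.inE => /and3P[_ /eqP Ak /forall_inP Anew] A'D.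
    move=> /andP[AX XA] /andP[A'X XA'].
    have le_A : (#|A'| <= #|A|)%N.
      case/finset.setUP: A'D => [/(fintype.subsetP sDU)|]; rewrite finset.inE Ak.
        by case/andP=> _ /ltnW.
      by case/and3P=> _ /eqP->.
    have AA' := exch _ _ le_A (fintype.subset_trans AX XA')
      (fintype.subset_trans A'X XA).
    case/finset.setUP: A'D => [/Anew|].
      by rewrite AA' (fintype.subset_trans AX XA').
    rewrite finset.inE => /and3P[_ /eqP A'k _].
    by apply/esym/eqP; rewrite eqEcard AA' Ak A'k /=.
  move=> A A' X AD A'D AX A'X.
  case/finset.setUP: (AD) => [AD0 | Anew]; last exact: newP AX A'X.
  case/finset.setUP: (A'D) => [A'D0 | A'new]; first exact: disj AX A'X.
  exact/esym/(newP _ _ _ A'new AD A'X AX).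
Qed.

(** * From interval partitions to Stanley decompositions *)

(** The set of variables that divide a monomial. *)
Definition mnm_supp n (m : 'X_{1..n}) : {set 'I_n} := [set i | m i != 0%N].

(** The exponent of the squarefree monomial [x^A]. *)
Definition mnm_of_set n (A : {set 'I_n}) : 'X_{1..n} :=
  [multinom (i \in A : nat) | i < n].

Lemma mnm_of_setK n (A : {set 'I_n}) : mnm_supp (mnm_of_set A) = A.
Proof. by apply/finset.setP => i; rewrite finset.inE mnmE; case: (i \in A). Qed.

Lemma mnm_suppD n (m m' : 'X_{1..n}) :
  mnm_supp (m + m')%MM = mnm_supp m :|: mnm_supp m'.
Proof.
by apply/finset.setP => i; rewrite !finset.inE mnmDE addn_eq0 negb_and.
Qed.

Lemma squarefree_le_supp n (m m' : 'X_{1..n}) :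
  (forall i, (m i <= 1)%N) -> (m <= m')%MM = (mnm_supp m \subset mnm_supp m').
Proof.
move=> sqf; apply/mnm_lepP/fintype.subsetP => H i; have := H i;
  rewrite ?finset.inE.
  by lia.
by have := sqf i; case: (m i) => [|[|k]] // _ /(_ isT); lia.
Qed.

(** [x^A K[Z]] is spanned by the monomials whose support lies in [[A, Z]]. *)
Lemma stanley_space_set (K : fieldType) n (A Z : {set 'I_n})
    (f : {mpoly K[n]}) : A \subset Z ->
  stanley_space 'X_[mnm_of_set A] Z f <->
  forall m, m \in msupp f -> (A \subset mnm_supp m) && (mnm_supp m \subset Z).
Proof.
move=> AZ; split=> [[p pZ ->] m | fAZ].
  rewrite (perm_mem (msuppMX _ _)) => /mapP[m' m'p ->].
  rewrite mnm_suppD mnm_of_setK finset.subsetUl finset.subUset AZ /=.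
  by apply/fintype.subsetP => i; rewrite finset.inE => m'i; apply: pZ m'i.
pose a := mnm_of_set A.
pose p : {mpoly K[n]} := \sum_(m <- msupp f) f@_m *: 'X_[(m - a)%MM].
have fE : f = p * 'X_[a].
  rewrite {1}[f]mpolyE /p big_distrl /= big_seq [RHS]big_seq.
  apply: eq_bigr => m mf; rewrite -scalerAl -mpolyXD submK //.
  rewrite squarefree_le_supp ?mnm_of_setK; first by case/andP: (fAZ m mf).
  by move=> i; rewrite mnmE; case: (i \in A).
exists p => // m i mp mi; have : (a + m)%MM \in msupp f.
  by rewrite fE (perm_mem (msuppMX _ _)) map_f.
case/fAZ/andP=> _ /fintype.subsetP; apply.
by rewrite mnm_suppD !finset.inE mi orbT.
Qed.

(** A squarefree monomial ideal is spanned by the monomials whose support lies in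
    some up-closed family. *)
Lemma squarefree_ideal_supp (K : fieldType) n (I : set {mpoly K[n]}) :
  squarefree_monomial_ideal I ->
  exists U : {set {set 'I_n}},
    (forall A B : {set 'I_n}, A \in U -> A \subset B -> B \in U) /\
    (forall f, I f <-> forall m, m \in msupp f -> mnm_supp m \in U).
Proof.
move=> [G Gsqf ->].
pose U := [set A : {set 'I_n} |
  `[< exists2 m : 'X_{1..n}, G 'X_[m] & mnm_supp m \subset A >]].
exists U; split=> [A B | f].
  rewrite !finset.inE => /asboolP[m Gm mA] AB; apply/asboolP.
  by exists m => //; apply: fintype.subset_trans AB.
split=> [[r [c [g [Gg ->]]]] m | fU].
  move=> /msupp_sum_le/flattenP[_ /mapP[i _ ->]].
  have [mi _ Egi] := Gsqf _ (Gg i).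
  rewrite Egi (perm_mem (msuppMX _ _)) => /mapP[m' _ ->].
  rewrite finset.inE; apply/asboolP; exists mi; first by rewrite -Egi.
  by rewrite mnm_suppD finset.subsetUl.
have /choice[mm mmP] (i : 'I_(size (msupp f))) :
    exists m : 'X_{1..n}, G 'X_[m] /\ (m <= (nth 0%MM (msupp f) i))%MM.
  have /fU : (nth 0%MM (msupp f) i) \in msupp f by rewrite mem_nth.
  rewrite finset.inE => /asboolP[m Gm mf]; exists m; split=> //.
  rewrite squarefree_le_supp //.
  have [m' sqf /(congr1 (@msupp _ _))] := Gsqf _ Gm.
  by rewrite !msuppX => -[->].
exists (size (msupp f)),
  (fun i : 'I_(size (msupp f)) => let m := nth 0%MM (msupp f) i in
     f@_m *: 'X_[(m - mm i)%MM]),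
  (fun i => 'X_[mm i]); split=> [i|]; first by case: (mmP i).
rewrite {1}[f]mpolyE (big_nth 0%MM) big_mkord; apply: eq_bigr => i _.
by rewrite -scalerAl -mpolyXD submK //; case: (mmP i).
Qed.

(** The sum of the terms of [f] whose monomial satisfies [P]. *)
Definition mpoly_part (K : fieldType) n (P : pred 'X_{1..n})
    (f : {mpoly K[n]}) : {mpoly K[n]} :=
  \sum_(m <- msupp f | P m) f@_m *: 'X_[m].

Lemma mcoeff_part (K : fieldType) n P (f : {mpoly K[n]}) k :
  (mpoly_part P f)@_k = if P k then f@_k else 0.
Proof.
rewrite /mpoly_part raddf_sum /=.
under eq_bigr => m _ do rewrite mcoeffZ mcoeffX.
have [kf | kNf] := boolP (k \in msupp f); last first.
  rewrite (memN_msupp_eq0 kNf) if_same big_seq_cond big1 // => m /andP[mf _].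
  by case: eqP => [mk | _]; rewrite ?mulr0 // -mk mf in kNf *.
rewrite big_mkcond (bigD1_seq k) ?msupp_uniq //= eqxx mulr1.
rewrite [X in _ + X]big1 ?addr0 // => m /negPf->.
by rewrite mulr0 if_same.
Qed.

Lemma stanley_decomposition_of_partition (K : fieldType) n
    (I : set {mpoly K[n]}) (U D : {set {set 'I_n}})
    (top : {set 'I_n} -> {set 'I_n}) :
  (forall A B : {set 'I_n}, A \in U -> A \subset B -> B \in U) ->
  (forall f, I f <-> forall m, m \in msupp f -> mnm_supp m \in U) ->
  (forall A : {set 'I_n}, A \subset top A) -> D \subset U ->
  (forall X, X \in U ->
     exists2 A, A \in D & (A \subset X) && (X \subset top A)) ->
  (forall A A' X : {set 'I_n}, A \in D -> A' \in D ->
     (A \subset X) && (X \subset top A) ->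
     (A' \subset X) && (X \subset top A') -> A = A') ->
  stanley_decomposition I
    (fun i : 'I_#|D| => 'X_[mnm_of_set (enum_val i)])
    (fun i : 'I_#|D| => top (enum_val i)).
Proof.
move=> upU IU sub_top sDU cov disj.
have inU (i : 'I_#|D|) : enum_val i \in U.
  exact: fintype.subsetP sDU _ (enum_valP i).
have uniq_i (i j : 'I_#|D|) (X : {set 'I_n}) :
    (enum_val i \subset X) && (X \subset top (enum_val i)) ->
    (enum_val j \subset X) && (X \subset top (enum_val j)) -> i = j.
  move=> iX jX; apply: enum_val_inj.
  exact: disj (enum_valP i) (enum_valP j) iX jX.
have spaceP (i : 'I_#|D|) (f : {mpoly K[n]}) :=
  stanley_space_set f (sub_top (enum_val i)).
split.
- move=> i; apply/IU => m; rewrite msuppX finset.inE => /eqP->.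
  by rewrite mnm_of_setK.
- move=> i; exists (\row_j (mnm_of_set (enum_val i) j)%:Z) => m.
  by rewrite msuppX mem_seq1 => /eqP-> j; rewrite mxE.
- move=> i p _ /eqP; rewrite mulf_eq0 => /orP[/eqP // |].
  by rewrite -msupp_eq0 msuppX.
- move=> f; rewrite IU; split=> [fU | [w wS ->] m].
    pose P (i : 'I_#|D|) (m : 'X_{1..n}) :=
      (enum_val i \subset mnm_supp m) && (mnm_supp m \subset top (enum_val i)).
    exists (fun i => mpoly_part (P i) f) => [i|].
      apply/spaceP => m; rewrite mcoeff_msupp mcoeff_part.
      by case: ifP => // _; rewrite eqxx.
    apply/mpolyP => k; rewrite raddf_sum /=.
    under eq_bigr => i _ do rewrite mcoeff_part.
    have [kf | kNf] := boolP (k \in msupp f); last first.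
      by rewrite (memN_msupp_eq0 kNf) big1 // => i _; rewrite if_same.
    have [A AD AX] := cov _ (fU k kf).
    have Ai : enum_val (enum_rank_in AD A) = A by rewrite enum_rankK_in.
    rewrite (bigD1 (enum_rank_in AD A)) //= {1}/P Ai AX big1 ?addr0 // => j ji.
    case: ifP => // Pj; case/eqP: ji; apply: uniq_i Pj _.
    by rewrite Ai.
  move=> /msupp_sum_le/flattenP[_ /mapP[i _ ->]] mi.
  by have /spaceP/(_ m mi)/andP[/(upU _ _ (inU i))] := wS i.
- move=> w wS w0 i; apply/mpolyP => k; rewrite mcoeff0.
  have := congr1 (mcoeff k) w0; rewrite raddf_sum /= mcoeff0 (bigD1 i) //=.
  have [ki | /memN_msupp_eq0 // _] := boolP (k \in msupp (w i)).
  rewrite big1 ?addr0 // => j ji; apply: memN_msupp_eq0.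
  apply: contra ji => kj; apply/eqP.
  have /spaceP/(_ k ki) := wS i; have /spaceP/(_ k kj) := wS j.
  exact: uniq_i.
Qed.

Lemma decomposition_sdepth_ge n r (Z : 'I_r -> {set 'I_n}) t :
  (t <= n)%N -> (forall i, (t <= #|Z i|)%N) -> (t <= decomposition_sdepth Z)%N.
Proof.
move=> tn tZ; apply: (big_ind (fun d => (t <= d)%N)) => // x y tx ty.
by rewrite leq_min tx ty.
Qed.

Lemma decomposition_sdepth_le n r (Z : 'I_r -> {set 'I_n}) :
  (decomposition_sdepth Z <= n)%N.
Proof.
rewrite /decomposition_sdepth; elim/big_rec: _ => // i d _.
by apply: leq_trans; apply: geq_minr.
Qed.

Lemma sdepth_ge (K : fieldType) n (I : set {mpoly K[n]}) r u
    (Z : 'I_r -> {set 'I_n}) :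
  stanley_decomposition I u Z -> (decomposition_sdepth Z <= sdepth I)%N.
Proof.
move=> dec.
have lt_n : (decomposition_sdepth Z < n.+1)%N.
  by rewrite ltnS decomposition_sdepth_le.
rewrite /sdepth -[X in (X <= _)%N]/(val (Ordinal lt_n)).
by apply: leq_bigmax_cond; apply/asboolP; exists r, u, Z.
Qed.

(** * Arithmetic of the bound *)

(** The largest integer is nonnegative because [t = 0] satisfies the
    inequality. *)
Lemma largest_nat_bounds n (s : int) :
  is_largest_int (fun t : int => (2 * t + 1) * (t + 1) <= n%:Z + 1) s ->
  exists k : nat, [/\ s = k%:Z, ((2 * k + 1) * (k + 1) <= n + 1)%N &
    (n + 1 < (2 * k + 3) * (k + 2))%N].
Proof.
move=> [/= le_s max_s]; have s_ge0 : 0 <= s by apply: max_s; lia.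
case: s le_s max_s s_ge0 => [k|k] // le_k max_k _; exists k; split=> [||] //.
rewrite ltnNge; apply/negP => le_n; have /= := max_k (k.+1%:Z).
have -> : (2 * k.+1%:Z + 1) * (k.+1%:Z + 1) = ((2 * k + 3) * (k + 2))%N%:Z by nia.
by move=> /(_ ltac:(lia)); lia.
Qed.

(** With [r] the square root, the two hypotheses say
    [2k + 3/2 <= r < 2k + 7/2]. *)
Lemma floor_sqrt_bound (R : realType) (n k : nat) :
  ((2 * k + 1) * (k + 1) <= n + 1)%N -> (n + 1 < (2 * k + 3) * (k + 2))%N ->
  Num.floor ((Num.sqrt (2 * n%:R + 9 / 4) + 1 / 2) / 2 : R) = k%:Z + 1.
Proof.
move=> lo hi; set r := Num.sqrt _.
have r_ge0 : 0 <= r := sqrtr_ge0 _.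
have rr : r ^+ 2 = 2 * n%:R + 9 / 4 :> R.
  by rewrite sqr_sqrtr //; have : 0 <= n%:R :> R by []; lra.
have lo' : (2 * k%:R + 1) * (k%:R + 1) <= n%:R + 1 :> R.
  by move: lo; rewrite -(ler_nat R) !(natrM, natrD).
have hi' : n%:R + 1 < (2 * k%:R + 3) * (k%:R + 2) :> R.
  by move: hi; rewrite -(ltr_nat R) !(natrM, natrD).
have k_ge0 : 0 <= k%:R :> R by [].
have le_r : 2 * k%:R + 3 / 2 <= r by nra.
have lt_r : r < 2 * k%:R + 7 / 2 by nra.
apply: floor_def; rewrite !intrD /= -!pmulrn; apply/andP; split; lra.
Qed.

Unset Implicit Arguments.
Local Open Scope classical_set_scope.

Theorem theorem3p4 (K : fieldType) (R : realType) (n : nat) (s : int)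
  (n_ge1 : (1 <= n)%N)
  (s_largest : is_largest_int
     (fun t : int => (2 * t + 1) * (t + 1) <= n%:Z + 1) s) :
  (forall I : set {mpoly K[n]},
     squarefree_monomial_ideal I -> (exists2 f, I f & f != 0) ->
     2 * s + 1 <= (sdepth I)%:Z)
  /\ 2 * s + 1
     = 2 * Num.floor ((Num.sqrt (2 * n%:R + 9 / 4) + 1 / 2) / 2 : R) - 1.
Proof.
have [k [-> lo hi]] := largest_nat_bounds s_largest.
split; last by rewrite (floor_sqrt_bound R lo hi); ring.
move=> I sqfI _; have [U [upU IU]] := squarefree_ideal_supp sqfI.
have [D [sDU cov disj]] := greedy_interval_partition U (sub_interval_top k)
  (fun A A' => interval_top_exchange n_ge1 lo).
have dec := stanley_decomposition_of_partition upU IU (sub_interval_top k)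
  sDU cov disj.
have le_n : (2 * k + 1 <= n)%N by case: k lo {hi cov disj dec} => [|k]; nia.
have := leq_trans (decomposition_sdepth_ge le_n
  (fun i : 'I_#|D| => card_interval_top (enum_val i) n_ge1 lo)) (sdepth_ge dec).
by lia.
Qed.
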